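(* Fix an integer $\Delta\ge 2$ (treated as a constant). After a precomputation of tables of total size $O(n^2)$ in time $O(n^2)$, there is an algorithm which, given an integer $R$ with $1\le R\le |T_n^\Delta|$, outputs the codeword of the tree in $T_n^\Delta$ whose rank (position, starting from $1$, in the list of all trees of $T_n^\Delta$ sorted in A-order) is $R$, in $O(n\log n)$ time.
   Context: A $T^\Delta$ tree is an unlabeled ordered (plane) rooted tree in which every node has at most $\Delta$ children; $T_n^\Delta$ denotes the set of $T^\Delta$ trees with $n$ nodes. For a tree $T$, $|T|$ is its number of nodes, $\deg(T)$ the number of children of its root, and $T_1,T_2,\dots$ the subtrees rooted at the children of the root from left to right. A-order: for $T^\Delta$ trees $T,T'$ with $k=\max\{\deg(T),\deg(T')\}$, $T\prec_A T'$ iff either $|T|<|T'|$, or $|T|=|T'|$ and for some $1\le i\le k$ one has $T_j=_A T'_j$ for all $j<i$ and $T_i\prec_A T'_i$. The codeword of a $T^\Delta$ tree: the root is labeled $s$; for every internal node, if it has exactly one child that child is labeled $s$, otherwise its leftmost child is labeled $\ell$, its rightmost child $r$, and all children in between $m$; the codeword is the sequence of labels in pre-order. *)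

(* Defs.v *)
From mathcomp Require Export all_boot.
From Stdlib Require List Sorted.
Set Implicit Arguments.
Unset Strict Implicit.
Unset Printing Implicit Defensive.

(** * Trees *)

Inductive tree : Type := Node of seq tree.

Fixpoint tsize (t : tree) : nat :=
  let: Node ts := t in (sumn (map tsize ts)).+1.

Fixpoint max_children (D : nat) (t : tree) : bool :=
  let: Node ts := t in (size ts <= D) && all (max_children D) ts.

Definition in_T (D n : nat) (t : tree) : Prop := max_children D t /\ tsize t = n.

(* The A-order compares T_i with T'_i for all i up to the larger of the two
   root degrees, so subtrees may be missing; [None] is the empty tree, with 0
   nodes. Subtree indices start from 0, so T_i is [osubtree (Some T) i.-1]. *)
Definition osize (T : option tree) : nat := if T is Some t then tsize t else 0.

Definition odeg (T : option tree) : nat :=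
  if T is Some (Node ts) then size ts else 0.

Definition osubtree (T : option tree) (i : nat) : option tree :=
  if T is Some (Node ts) then onth ts i else None.

Inductive precA : option tree -> option tree -> Prop :=
| precA_size T T' :
    osize T < osize T' -> precA T T'
| precA_subtree T T' i :
    osize T = osize T' ->
    i < maxn (odeg T) (odeg T') ->
    (forall j, j < i -> osubtree T j = osubtree T' j) ->
    precA (osubtree T i) (osubtree T' i) ->
    precA T T'.

Definition A_sorted_list (D n : nat) (s : seq tree) : Prop :=
  [/\ forall t, List.In t s <-> in_T D n t,
      List.NoDup s
    & Sorted.StronglySorted (fun t t' => precA (Some t) (Some t')) s].

Inductive label : Type := lab_s | lab_l | lab_m | lab_r.

(* Label of the [j]-th child, counted from 0, of a node with [k] children. *)
Definition child_label (k j : nat) : label :=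
  if k == 1 then lab_s
  else if j == 0 then lab_l
  else if j == k.-1 then lab_r
  else lab_m.

Fixpoint code (t : tree) (l : label) : seq label :=
  let: Node ts := t in
  l :: flatten [seq p.1 p.2 | p <- zip [seq code u | u <- ts]
                                       (mkseq (child_label (size ts)) (size ts))].

Definition codeword (t : tree) : seq label := code t lab_s.

(** * Unit-cost RAM *)

(* A random access machine with structured control flow. It has registers, a
   read-write memory, a read-only table and a write-only output tape of labels;
   registers, memory and table are indexed by nat. An instruction or test takes
   one unit of time. Registers hold words of [w] bits: there is no rule for an
   instruction that would put a value >= 2 ^ w in a register, so a derivation
   of [exec] is a terminating run without overflow. The numbers of trees with n
   nodes are 2 ^ Theta(n), hence w = O(n) in the theorem. Bounding the words
   prevents coding a whole table into one integer. *)

Inductive binop : Type := Add | Sub | Mul | Div.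

(* Sub is truncated, and Div is the integer quotient. *)
Definition eval_binop (o : binop) : nat -> nat -> nat :=
  match o with Add => addn | Sub => subn | Mul => muln | Div => divn end.

Inductive test : Type := TestEq of nat & nat | TestLt of nat & nat.

Inductive cmd : Type :=
| Skip
| Const of nat & nat                (* r[x] := c *)
| Move of nat & nat                 (* r[x] := r[y] *)
| Op of nat & binop & nat & nat     (* r[x] := r[y] o r[z] *)
| ReadMem of nat & nat              (* r[x] := memory[r[y]] *)
| WriteMem of nat & nat             (* memory[r[x]] := r[y] *)
| ReadTab of nat & nat              (* r[x] := table[r[y]] *)
| Output of label
| Seq of cmd & cmd
| If of test & cmd & cmd
| While of test & cmd.

Record state : Type := State {
  reg : nat -> nat;
  memory : nat -> nat;
  out : seq label
}.

Definition update (f : nat -> nat) (a v : nat) : nat -> nat :=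
  fun b => if b == a then v else f b.

Definition set_reg (x v : nat) (st : state) : state :=
  State (update (reg st) x v) (memory st) (out st).

Definition set_memory (a v : nat) (st : state) : state :=
  State (reg st) (update (memory st) a v) (out st).

Definition emit (l : label) (st : state) : state :=
  State (reg st) (memory st) (rcons (out st) l).

Definition eval_test (b : test) (st : state) : bool :=
  match b with
  | TestEq x y => reg st x == reg st y
  | TestLt x y => reg st x < reg st y
  end.

(* [exec w tab c st st' t]: with word size [w] and table [tab], the program [c]
   run from [st] halts in [st'] after [t] units of time. *)
Inductive exec (w : nat) (tab : nat -> nat) :
  cmd -> state -> state -> nat -> Prop :=
| exec_Skip st :
    exec w tab Skip st st 1
| exec_Const x c st :
    c < 2 ^ w -> exec w tab (Const x c) st (set_reg x c st) 1
| exec_Move x y st :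
    reg st y < 2 ^ w -> exec w tab (Move x y) st (set_reg x (reg st y) st) 1
| exec_Op x o y z st :
    eval_binop o (reg st y) (reg st z) < 2 ^ w ->
    exec w tab (Op x o y z) st
      (set_reg x (eval_binop o (reg st y) (reg st z)) st) 1
| exec_ReadMem x y st :
    memory st (reg st y) < 2 ^ w ->
    exec w tab (ReadMem x y) st (set_reg x (memory st (reg st y)) st) 1
| exec_WriteMem x y st :
    exec w tab (WriteMem x y) st (set_memory (reg st x) (reg st y) st) 1
| exec_ReadTab x y st :
    tab (reg st y) < 2 ^ w ->
    exec w tab (ReadTab x y) st (set_reg x (tab (reg st y)) st) 1
| exec_Output l st :
    exec w tab (Output l) st (emit l st) 1
| exec_Seq c1 c2 st1 st2 st3 t1 t2 :
    exec w tab c1 st1 st2 t1 -> exec w tab c2 st2 st3 t2 ->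
    exec w tab (Seq c1 c2) st1 st3 (t1 + t2)
| exec_IfTrue b c1 c2 st st' t :
    eval_test b st -> exec w tab c1 st st' t ->
    exec w tab (If b c1 c2) st st' t.+1
| exec_IfFalse b c1 c2 st st' t :
    ~~ eval_test b st -> exec w tab c2 st st' t ->
    exec w tab (If b c1 c2) st st' t.+1
| exec_WhileFalse b c st :
    ~~ eval_test b st -> exec w tab (While b c) st st 1
| exec_WhileTrue b c st1 st2 st3 t1 t2 :
    eval_test b st1 -> exec w tab c st1 st2 t1 ->
    exec w tab (While b c) st2 st3 t2 ->
    exec w tab (While b c) st1 st3 (t1 + t2).+1.

(* The inputs are in registers 0, 1, ...; everything else is 0 or empty. *)
Definition init (inputs : seq nat) : state :=
  State (nth 0 inputs) (fun=> 0) [::].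

Definition no_table : nat -> nat := fun=> 0.

Definition bigO (f g : nat -> nat) : Prop :=
  exists C n0, forall n, n0 <= n -> f n <= C * g n.

(* Main.v *)
From mathcomp Require Import all_boot zify.
From Stdlib Require List Sorted.
Require Import Defs.
Set Implicit Arguments.
Unset Strict Implicit.
Unset Printing Implicit Defensive.

(* Among trees of the same size, the A-order is the lexicographic order on the
   sequences of child subtrees, so a forest of at most k trees with m nodes is
   ranked by the size j + 1 of its first tree, then by the rank of that tree,
   then by the rank of the remaining forest (at most k - 1 trees, m - j - 1
   nodes). The table holds the partial sums over j of the number of such forests;
   it has O(n^2) entries and each is obtained from earlier ones in constant time.
   Unranking finds j by binary search in a row of the table and splits the residual
   rank by one division; a stack of pending forests yields the nodes in pre-order,
   with O(log n) time for each node. The label of a child depends only on whether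
   it is the first one and whether the remaining forest is empty, so it can be
   output at once. The counts are bounded by ballot numbers, hence fit in O(n)
   bits. *)

(** * Lists *)

Section Lists.
Context {A B : Type}.
Implicit Types (R : A -> A -> Prop) (s : seq A) (ss : seq (seq A)).

Lemma In_map (f : A -> B) y s :
  List.In y [seq f x | x <- s] <-> exists2 x, List.In x s & y = f x.
Proof.
elim: s => [|a s IH] /=; first by split=> // -[].
rewrite IH; split; first by case=> [<-|[x]]; [exists a | exists x]; auto.
by case=> x [->|xs] ->; [left | right; exists x].
Qed.

Lemma eq_In_map (f g : A -> B) s :
  (forall x, List.In x s -> f x = g x) -> map f s = map g s.
Proof.
elim: s => //= a s IH efg; rewrite efg; last by left.
by rewrite IH // => x xs; apply: efg; right.
Qed.

Lemma In_nth x0 s i : i < size s -> List.In (nth x0 s i) s.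
Proof. by elim: s i => // a s IH [|i] /= ilt; [left | right; apply: IH]. Qed.

Lemma In_flatten x ss :
  List.In x (flatten ss) <-> exists2 s, List.In s ss & List.In x s.
Proof.
elim: ss => [|s ss IH] /=; first by split=> // -[].
rewrite List.in_app_iff IH; split.
  by case=> [xs|[s' ? ?]]; [exists s | exists s']; auto.
by case=> s' [->|s'ss] xs'; [left | right; exists s'].
Qed.

Lemma In_iota i a n : List.In i (iota a n) <-> a <= i < a + n.
Proof.
elim: n a => [|n IH] a /=; first by split=> //; lia.
rewrite IH; lia.
Qed.

Lemma StronglySorted_cat R s1 s2 :
  Sorted.StronglySorted R s1 -> Sorted.StronglySorted R s2 ->
  (forall x y, List.In x s1 -> List.In y s2 -> R x y) ->
  Sorted.StronglySorted R (s1 ++ s2).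
Proof.
move=> + sort2; elim: s1 => [//|a s1 IH] sort1 R12 /=.
have [sort_s1 a_s1] := Sorted.StronglySorted_inv sort1.
apply: Sorted.SSorted_cons; first by apply: IH => // x y xs ys; apply: R12 => //; right.
apply/List.Forall_forall => x /List.in_app_iff[|xs2].
  by move: x; apply/List.Forall_forall.
by apply: R12 => //; left.
Qed.

Lemma StronglySorted_flatten R ss :
  (forall s, List.In s ss -> Sorted.StronglySorted R s) ->
  Sorted.StronglySorted
    (fun s s' => forall x y, List.In x s -> List.In y s' -> R x y) ss ->
  Sorted.StronglySorted R (flatten ss).
Proof.
elim: ss => [|s ss IH] sorts sortss /=; first exact: Sorted.SSorted_nil.
have [sort_ss s_ss] := Sorted.StronglySorted_inv sortss.
apply: StronglySorted_cat; first by apply: sorts; left.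
  by apply: IH => // s' *; apply: sorts; right.
move=> x y xs /In_flatten[s' s'ss ys'].
by move/List.Forall_forall: s_ss => /(_ s' s'ss); apply.
Qed.

Lemma StronglySorted_map R (R' : B -> B -> Prop) (f : A -> B) s :
  (forall x y, List.In x s -> List.In y s -> R x y -> R' (f x) (f y)) ->
  Sorted.StronglySorted R s -> Sorted.StronglySorted R' (map f s).
Proof.
elim: s => [|a s IH] homf sort_s /=; first exact: Sorted.SSorted_nil.
have [sort_s' a_s] := Sorted.StronglySorted_inv sort_s.
apply: Sorted.SSorted_cons.
  by apply: IH => // x y xs ys; apply: homf; right.
apply/List.Forall_forall => _ /In_map[x xs ->].
apply: homf; [by left | by right |].
by move/List.Forall_forall: a_s; apply.
Qed.

Lemma StronglySorted_NoDup R s :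
  (forall x, ~ R x x) -> Sorted.StronglySorted R s -> List.NoDup s.
Proof.
move=> irrR; elim: s => [|a s IH] sort_s; first exact: List.NoDup_nil.
have [/IH ? a_s] := Sorted.StronglySorted_inv sort_s.
apply: List.NoDup_cons => // /(proj1 (List.Forall_forall _ _) a_s).
exact: irrR.
Qed.

End Lists.

Lemma StronglySorted_iota a n :
  Sorted.StronglySorted (fun i j => i < j) (iota a n).
Proof.
elim: n a => [|n IH] a /=; first exact: Sorted.SSorted_nil.
apply: Sorted.SSorted_cons => //.
by apply/List.Forall_forall => i /In_iota /andP[].
Qed.

(** * Forests in A-order *)

Lemma tsize_gt0 t : 0 < tsize t.
Proof. by case: t. Qed.

(** The subtree clause of [precA], on child sequences. A missing tree is [None], of size 0, so a
    sequence precedes its proper extensions. *)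
Definition lexA (ts ts' : seq tree) : Prop :=
  exists i, [/\ i < maxn (size ts) (size ts'),
    forall j, j < i -> onth ts j = onth ts' j & precA (onth ts i) (onth ts' i)].

Lemma lexA_head t t' ts ts' :
  precA (Some t) (Some t') -> lexA (t :: ts) (t' :: ts').
Proof. by exists 0; split => //=; lia. Qed.

Lemma lexA_cons t ts ts' : lexA ts ts' -> lexA (t :: ts) (t :: ts').
Proof.
case=> i [ilt eqi preci]; exists i.+1; split => //=; first lia.
by case=> [|j] //= ji; apply: eqi.
Qed.

Lemma precA_Node ts ts' :
  sumn (map tsize ts) = sumn (map tsize ts') -> lexA ts ts' ->
  precA (Some (Node ts)) (Some (Node ts')).
Proof.
move=> eq_size [i [ilt eqi preci]].
by apply: (@precA_subtree _ _ i) => //=; rewrite eq_size.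
Qed.

Lemma osize_osubtree T i : 0 < osize T -> osize (osubtree T i) < osize T.
Proof.
case: T => [[ts]|] //= _; rewrite ltnS.
elim: ts i => [|t ts IH] [|i] //=; first exact: leq_addr.
exact: leq_trans (IH i) (leq_addl _ _).
Qed.

(** Induction on the size: the size clause fails on equal arguments, and the subtree clause makes a
    smaller tree precede itself. *)
Lemma precA_irr T : ~ precA T T.
Proof.
have [n] := ubnP (osize T); elim: n T => // n IH T ltn prec.
have [eqT|gt0] := posnP (osize T).
  case: T eqT prec {ltn} => [t /=|_]; first by have := tsize_gt0 t; lia.
  (* The empty tree has no size below its own and no index below its degree 0. *)
  by move: {1 2}None (erefl (osize None)) => T; inversion 2; subst; rewrite ?maxnn //=; lia.
inversion prec; subst; first by rewrite ltnn in H.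
apply: IH H2; have := osize_osubtree i gt0; lia.
Qed.

(* [forests D k m] lists, in A-order, the sequences of at most [k] trees of
   degree at most [D] with [m] nodes in total. *)
Fixpoint forests_rec (D fuel k m : nat) : seq (seq tree) :=
  match m, fuel, k with
  | 0, _, _ => [:: [::]]
  | m'.+1, f.+1, k'.+1 =>
      flatten [seq [seq Node us :: ts | us <- forests_rec D f D j,
                                        ts <- forests_rec D f k' (m' - j)]
              | j <- iota 0 m'.+1]
  | _, _, _ => [::]
  end.

Definition forests (D k m : nat) : seq (seq tree) := forests_rec D m k m.

Lemma forests_recS D f k m :
  forests_rec D f.+1 k.+1 m.+1 =
  flatten [seq [seq Node us :: ts | us <- forests_rec D f D j,
                                    ts <- forests_rec D f k (m - j)]
          | j <- iota 0 m.+1].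
Proof. by []. Qed.

(** Every recursive call drops at least the root of the first tree, so fuel equal to the number of
    nodes never runs out. *)
Lemma forests_fuel D f g k m :
  m <= f -> m <= g -> forests_rec D f k m = forests_rec D g k m.
Proof.
elim: f g k m => [|f IH] [|g] [|k] [|m] // mf mg.
rewrite !forests_recS; congr flatten; apply: eq_In_map => j /In_iota jm.
rewrite (IH g D j) //; try lia.
by rewrite (IH g k (m - j)) //; lia.
Qed.

Lemma forestsS D k m :
  forests D k.+1 m.+1 =
  flatten [seq [seq Node us :: ts | us <- forests D D j, ts <- forests D k (m - j)]
          | j <- iota 0 m.+1].
Proof.
rewrite /forests forests_recS; congr flatten; apply: eq_In_map => j /In_iota jm.
rewrite (@forests_fuel D m j D j) //; try lia.
by rewrite (@forests_fuel D m (m - j) k) //; lia.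
Qed.

Lemma forests0 D k : forests D k 0 = [:: [::]].
Proof. by []. Qed.

Lemma forests0S D m : forests D 0 m.+1 = [::].
Proof. by []. Qed.

Lemma In_forests D k m ts :
  List.In ts (forests D k m) <->
  [/\ size ts <= k, all (max_children D) ts & sumn (map tsize ts) = m].
Proof.
have [b] := ubnP m; elim: b k m ts => // b IH k [|m] ts mb.
  rewrite forests0; split=> [[<-|]|] //.
  by case: ts => [|t ts] [] //=; [left | have := tsize_gt0 t; lia].
case: k => [|k]; first by rewrite forests0S; split=> // -[]; case: ts.
rewrite forestsS; split.
  case/In_flatten=> _ /In_map[j /In_iota jm ->] /In_flatten[_ /In_map[us + ->]].
  rewrite IH; last lia; move=> [us1 us2 us3] /In_map[ts' + ->].
  rewrite IH; last lia; move=> [ts1 ts2 ts3] /=.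
  by rewrite us1 us2 ts2 us3 ts3; split=> //; lia.
case: ts => [|[us] ts] [] // ts1 /andP[/andP[us1 us2] ts2] ts3.
rewrite /= in ts1 ts3.
(* [j] nodes lie below the root of the first tree; this selects the block that contains the
   forest. *)
set j := sumn (map tsize us) in ts3.
apply/In_flatten; exists [seq Node us :: ts | us <- forests D D j, ts <- forests D k (m - j)].
  apply/In_map; exists j => //; apply/In_iota; lia.
apply/In_flatten; exists [seq Node us :: ts | ts <- forests D k (m - j)].
  apply/In_map; exists us => //; apply/IH; last by split.
  lia.
by apply/In_map; exists ts => //; apply/IH; [lia | split=> //; lia].
Qed.

(** The nesting of the list follows the order: different [j] are decided by size, different [us] of
    equal size by [precA_Node], equal [us] by the tails. *)
Lemma sorted_forests D k m : Sorted.StronglySorted lexA (forests D k m).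
Proof.
have [b] := ubnP m; elim: b k m => // b IH k [|m] mb.
  by rewrite forests0; apply: Sorted.SSorted_cons => //; apply: Sorted.SSorted_nil.
case: k => [|k]; first by rewrite forests0S; apply: Sorted.SSorted_nil.
rewrite forestsS; apply: StronglySorted_flatten.
  move=> _ /In_map[j /In_iota jm ->]; apply: StronglySorted_flatten.
    move=> _ /In_map[us _ ->]; apply: (StronglySorted_map (R := lexA)).
      by move=> ts ts' _ _; apply: lexA_cons.
    by apply: IH; lia.
  apply: (StronglySorted_map (R := lexA)); last by apply: IH; lia.
  move=> us us' /In_forests[_ _ us3] /In_forests[_ _ us3'] lt_us.
  move=> _ _ /In_map[ts _ ->] /In_map[ts' _ ->].
  by apply/lexA_head/precA_Node; rewrite // us3.
apply: (StronglySorted_map (R := fun i j => i < j)); last exact: StronglySorted_iota.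
move=> i j _ _ ij ? ? /In_flatten[_ /In_map[us /In_forests[_ _ us3] ->]].
move=> /In_map[ts _ ->] /In_flatten[_ /In_map[us' /In_forests[_ _ us3'] ->]].
by move=> /In_map[ts' _ ->]; apply/lexA_head/precA_size; rewrite /= us3 us3'.
Qed.

Lemma A_sorted_forests D n :
  A_sorted_list D n.+1 [seq Node ts | ts <- forests D D n].
Proof.
have sorted_trees : Sorted.StronglySorted
    (fun t t' => precA (Some t) (Some t')) [seq Node ts | ts <- forests D D n].
  apply: (StronglySorted_map (R := lexA)); last exact: sorted_forests.
  move=> ts ts' /In_forests[_ _ ts3] /In_forests[_ _ ts3'].
  by apply: precA_Node; rewrite ts3.
split=> //; last by apply: StronglySorted_NoDup sorted_trees => t; apply: precA_irr.
move=> t; rewrite In_map; split.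
  by case=> ts /In_forests[ts1 ts2 ts3] ->; split=> /=; rewrite ?ts1 ?ts3.
case: t => ts [/= /andP[ts1 ts2] [ts3]]; exists ts => //.
by apply/In_forests.
Qed.

(** * Counting *)

Definition cnt (D k m : nat) : nat := size (forests D k m).

(** For [0 < i <= m], counts the forests whose first tree has at most [i] nodes. At [i = 0] only the
    empty forest counts, which makes the entry at [i = m] right even for [m = 0]; entries with
    [i > m] pad the row. *)
Definition psum (D k m i : nat) : nat :=
  if i == 0 then (m == 0 : nat)
  else if (k == 0) || (m < i) then 0
  else \sum_(j < i) cnt D D j * cnt D k.-1 (m - j.+1).

Lemma cntS D k m :
  cnt D k.+1 m.+1 = \sum_(j < m.+1) cnt D D j * cnt D k (m - j).
Proof.
rewrite /cnt forestsS size_flatten /shape -map_comp sumnE big_map.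
rewrite -[X in iota 0 X]subn0 -/(index_iota _ _) big_mkord.
by apply: eq_bigr => j _; rewrite /= size_allpairs.
Qed.

Lemma psumS D k m i : 0 < k -> i < m ->
  psum D k m i.+1 = psum D k m i + cnt D D i * cnt D k.-1 (m - i.+1).
Proof.
case: k m => [|k] [|m] // _ im; rewrite /psum /= ltnNge im /=.
case: i im => [|i] im /=; first by rewrite big_ord_recr big_ord0.
by rewrite big_ord_recr /= ltnNge (ltnW im).
Qed.

(** The counts are thus entries of the table, and both programs look them up there. *)
Lemma psum_all D k m : psum D k m m = cnt D k m.
Proof.
case: k m => [|k] [|m] //; rewrite cntS /psum /= ltnn.
by apply: eq_bigr => j _; rewrite subSS.
Qed.

Lemma psum_mono D k m i j : 0 < k -> i <= j -> j <= m ->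
  psum D k m i <= psum D k m j.
Proof.
move=> k0 ij; have -> : j = i + (j - i) by lia.
elim: (j - i) => [|d IH] jm; first by rewrite addn0.
rewrite addnS psumS //; last lia.
by apply: leq_trans (IH _) (leq_addr _ _); lia.
Qed.

Lemma psum_le_cnt D k m i : psum D k m i <= cnt D k m.
Proof.
case: k => [|k].
  by case: i => [|i] //; case: m.
case: (leqP i m) => [im|mi]; first by rewrite -psum_all psum_mono.
by rewrite /psum mi orbT; case: i mi.
Qed.

Lemma nth_allpairs (A B C : Type) (f : A -> B -> C) x0 y0 z0 s t r :
  r < size s * size t ->
  nth z0 [seq f x y | x <- s, y <- t] r =
  f (nth x0 s (r %/ size t)) (nth y0 t (r %% size t)).
Proof.
elim: s r => [|x s IH] r //= rlt.
rewrite nth_cat size_map; case: ltnP => rt.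
  by rewrite (nth_map y0) // divn_small // modn_small.
have t0 : 0 < size t by case: (size t) rlt rt => //; lia.
rewrite IH; last lia.
by rewrite -[in RHS](subnK rt) divnDr ?dvdnn // divnn t0 addn1 modnDr.
Qed.

Lemma nth_flatten_iota (A : Type) x0 (F : nat -> seq A) a n j r :
  j < n ->
  \sum_(i < j) size (F (a + i)) <= r < \sum_(i < j.+1) size (F (a + i)) ->
  nth x0 (flatten [seq F i | i <- iota a n]) r =
  nth x0 (F (a + j)) (r - \sum_(i < j) size (F (a + i))).
Proof.
elim: n a j r => // n IH a [|j] r /= jn.
  by rewrite big_ord_recl !big_ord0 /= !addn0 nth_cat subn0 => ->.
have sumS p : \sum_(i < p.+1) size (F (a + i)) =
    size (F a) + \sum_(i < p) size (F (a.+1 + i)).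
  rewrite big_ord_recl addn0; congr (_ + _); apply: eq_bigr => i _.
  by rewrite lift0 addnS.
rewrite !sumS /=.
move=> /andP[r1 r2]; rewrite nth_cat; case: ltnP => [r3|rge]; first by exfalso; lia.
by rewrite (IH _ j) //; [rewrite addnS addSn subnDA | rewrite leq_subRL // r1 ltn_subLR].
Qed.

(** Block [j] starts at position [psum D k m j] and lists a product row by row, so dividing the
    offset by the number of tails gives the positions in both factors. *)
Lemma unrank_forest D k m j r :
  j < m -> psum D k m j <= r < psum D k m j.+1 ->
  let r' := r - psum D k m j in let c := cnt D k.-1 (m - j.+1) in
  [/\ 0 < k, r' %/ c < cnt D D j, r' %% c < c &
    nth [::] (forests D k m) r =
    Node (nth [::] (forests D D j) (r' %/ c))
      :: nth [::] (forests D k.-1 (m - j.+1)) (r' %% c)].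
Proof.
case: m => // m jm; case: k => [|k] rlt; first by rewrite /psum /= in rlt; lia.
move=> r' c; rewrite [k.+1.-1]/= [m.+1 - _]/= subSS in c *.
have r'lt : r' < cnt D D j * c.
  by move: rlt; rewrite psumS //= subSS -/c /r'; lia.
have c0 : 0 < c by case: (posnP c) r'lt => // ->; rewrite muln0.
have psumE i : i <= m.+1 -> psum D k.+1 m.+1 i =
    \sum_(i0 < i) size [seq Node us :: ts | us <- forests D D (0 + i0),
                                          ts <- forests D k (m - (0 + i0))].
  case: i => [|i] im; first by rewrite big_ord0.
  rewrite /psum /= ltnNge im /=; apply: eq_bigr => i0 _.
  by rewrite size_allpairs subSS.
split=> //; [by rewrite ltn_divLR | by rewrite ltn_mod |].
rewrite forestsS (@nth_flatten_iota _ _ _ _ _ j) //; last by rewrite -!psumE // ltnW.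
rewrite -psumE; last exact: ltnW.
by rewrite (nth_allpairs _ [::] [::]).
Qed.

(* The ballot recursion: [ballot m p] counts the sequences of [p] ordered forests
   with [m] nodes in total, according to whether the first forest is empty. *)
Fixpoint ballot (m p : nat) {struct m} : nat :=
  match m with
  | 0 => 1
  | m'.+1 => (fix go p := if p is p'.+1 then go p' + ballot m' p'.+2 else 0) p
  end.

Lemma ballotSS m p : ballot m.+1 p.+1 = ballot m.+1 p + ballot m p.+2.
Proof. by []. Qed.

(** Both terms of the recursion have a value of [2 * m + p] one below that of the left side. *)
Lemma ballot_le m p : ballot m p <= 2 ^ (2 * m + p).
Proof.
elim: m p => [|m IHm] p; first by rewrite expn_gt0.
elim: p => [|p IHp] //; rewrite ballotSS addnS expnS mul2n -addnn.
apply: leq_add => //; apply: leq_trans (IHm _) _.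
by rewrite leq_exp2l //; lia.
Qed.

(** A sequence of [p + q] forests splits into the first [p], with [j] nodes, and the last [q]. *)
Lemma ballot_conv m p q :
  \sum_(j < m.+1) ballot j p * ballot (m - j) q = ballot m (p + q).
Proof.
elim: m p => [|m IHm] p; first by rewrite big_ord1.
elim: p => [|p IHp].
  by rewrite big_ord_recl big1 ?addn0 ?mul1n // => i _; rewrite lift0.
rewrite addSn ballotSS -IHp -2!addSn -IHm big_ord_recl [in RHS]big_ord_recl.
rewrite -addnA -big_split; congr (_ + _); apply: eq_bigr => i _.
by rewrite lift0 ballotSS mulnDl subSS.
Qed.

(** [ballot m 1] is a Catalan number: for [p = q = 1], [ballot_conv] is the recursion of [cntS]
    without bounds on degrees. *)
Lemma cnt_le_ballot D k m : cnt D k m <= ballot m 1.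
Proof.
have [b] := ubnP m; elim: b k m => // b IH k [|m] mb; first by case: k.
case: k => [|k]; first by rewrite /cnt forests0S.
rewrite cntS ballotSS add0n -[2]/(1 + 1) -ballot_conv.
by apply: leq_sum => j _; have := ltn_ord j => jm; apply: leq_mul; apply: IH; lia.
Qed.

Lemma cnt_le D k m n : m < n -> cnt D k m <= 2 ^ (2 * n).
Proof.
move=> mn; apply: leq_trans (cnt_le_ballot D k m) (leq_trans (ballot_le _ _) _).
by rewrite leq_exp2l //; lia.
Qed.

(** * Codewords *)

Definition first_last_label (first last : bool) : label :=
  if first then (if last then lab_s else lab_l)
  else (if last then lab_r else lab_m).

(* The code of the last children of a node, of which at most [k] are allowed:
   these are all the children iff [k = D]. *)
Fixpoint forest_code (D k : nat) (ts : seq tree) : seq label :=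
  if ts is t :: ts' then
    code t (first_last_label (k == D) (nilp ts')) ++ forest_code D k.-1 ts'
  else [::].

Lemma code_Node D ts l :
  0 < D -> code (Node ts) l = l :: forest_code D D ts.
Proof.
move=> D0 /=; congr (_ :: _).
(* The children from position [a] on, after the first. Their capacity [k] is below [D], so none is
   taken for the first child; [0 < D] ensures this for [k = D.-1]. *)
have rest k a us : k < D -> 0 < a ->
    flatten [seq p.1 p.2 | p <- zip [seq code u | u <- us]
      [seq child_label (a + size us) i | i <- iota a (size us)]] =
    forest_code D k us.
  elim: us k a => [//|u us IH] k a kD a0 /=.
  rewrite addnS -addSn (IH k.-1) //; last lia.
  congr (code u _ ++ _); rewrite /child_label /first_last_label (ltn_eqF kD).
  have -> : (a.+1 + size us == 1) = false by lia.
  have -> : (a == 0) = false by lia.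
  by have -> : (a == (a.+1 + size us).-1) = nilp us by rewrite /nilp; lia.
case: ts => [//|t ts] /=; rewrite /mkseq /= -(rest D.-1 1 ts) //; last lia.
rewrite add1n; congr (code t _ ++ _); rewrite eqxx /child_label.
by case: ts.
Qed.

Lemma forest_code_Node D k us ts : 0 < D ->
  forest_code D k (Node us :: ts) =
  first_last_label (k == D) (nilp ts) :: forest_code D D us ++ forest_code D k.-1 ts.
Proof. by move=> D0; rewrite -cat_cons -code_Node. Qed.

(** * Program logic *)

(* The registers are described by a list, padded with zeros. *)
Definition wp (w : nat) (tab : nat -> nat) (c : cmd)
    (Q : seq nat -> (nat -> nat) -> seq label -> Prop) (t : nat)
    (rs : seq nat) (mem : nat -> nat) (o : seq label) : Prop :=
  forall f, f =1 nth 0 rs ->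
  exists f' rs' mem' o' t',
    [/\ exec w tab c (State f mem o) (State f' mem' o') t',
        t' <= t, f' =1 nth 0 rs' & Q rs' mem' o'].

Definition test_list (b : test) (rs : seq nat) : bool :=
  match b with
  | TestEq x y => nth 0 rs x == nth 0 rs y
  | TestLt x y => nth 0 rs x < nth 0 rs y
  end.

Section ProgramLogic.
Context (w : nat) (tab : nat -> nat).
Implicit Types (c : cmd) (rs : seq nat) (mem : nat -> nat) (o : seq label).
Implicit Types (Q : seq nat -> (nat -> nat) -> seq label -> Prop).
Local Notation wp := (wp w tab).

Lemma update_list f rs x v :
  f =1 nth 0 rs -> update f x v =1 nth 0 (set_nth 0 rs x v).
Proof. by move=> ef y; rewrite nth_set_nth /update /= ef. Qed.

Lemma eval_test_list b f rs mem o :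
  f =1 nth 0 rs -> eval_test b (State f mem o) = test_list b rs.
Proof. by move=> ef; case: b => x y /=; rewrite !ef. Qed.

Lemma wp_weaken c Q Q' t t' rs mem o :
  t <= t' -> (forall rs mem o, Q rs mem o -> Q' rs mem o) ->
  wp c Q t rs mem o -> wp c Q' t' rs mem o.
Proof.
move=> tt' QQ' cP f /cP[f' [rs' [mem' [o' [s [? st ? ?]]]]]].
exists f', rs', mem', o', s; split=> //; [exact: leq_trans tt' | exact: QQ'].
Qed.

(** The rules for single instructions accept any bound [t.+1], so that branches of different lengths
    share one bound. *)
Lemma wp_Skip Q t rs mem o : Q rs mem o -> wp Skip Q t.+1 rs mem o.
Proof.
by move=> Qs f ef; exists f, rs, mem, o, 1; split=> //; apply: exec_Skip.
Qed.

Lemma wp_Const x v Q t rs mem o :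
  v < 2 ^ w -> Q (set_nth 0 rs x v) mem o -> wp (Const x v) Q t.+1 rs mem o.
Proof.
move=> vw Qs f ef; exists (update f x v), (set_nth 0 rs x v), mem, o, 1.
by split=> //; [apply: exec_Const | apply: update_list].
Qed.

Lemma wp_Move x y Q t rs mem o :
  nth 0 rs y < 2 ^ w -> Q (set_nth 0 rs x (nth 0 rs y)) mem o ->
  wp (Move x y) Q t.+1 rs mem o.
Proof.
move=> vw Qs f ef; rewrite -ef in vw Qs.
exists (update f x (f y)), (set_nth 0 rs x (f y)), mem, o, 1.
by split=> //; [exact: exec_Move (State f mem o) vw | apply: update_list].
Qed.

(** The result [v] is kept apart from the expression computing it, so that register contents stay in
    a chosen form. *)
Lemma wp_Op v x op y z Q t rs mem o :
  eval_binop op (nth 0 rs y) (nth 0 rs z) = v -> v < 2 ^ w ->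
  Q (set_nth 0 rs x v) mem o -> wp (Op x op y z) Q t.+1 rs mem o.
Proof.
move=> ev vw Qs f ef; rewrite -!ef in ev.
exists (update f x v), (set_nth 0 rs x v), mem, o, 1.
split=> //; last exact: update_list.
by rewrite -{}ev in vw *; exact: exec_Op (State f mem o) vw.
Qed.

Lemma wp_ReadMem v x y Q t rs mem o :
  mem (nth 0 rs y) = v -> v < 2 ^ w ->
  Q (set_nth 0 rs x v) mem o -> wp (ReadMem x y) Q t.+1 rs mem o.
Proof.
move=> ev vw Qs f ef; rewrite -!ef in ev.
exists (update f x v), (set_nth 0 rs x v), mem, o, 1.
split=> //; last exact: update_list.
by rewrite -{}ev in vw *; exact: (@exec_ReadMem w tab x y (State f mem o) vw).
Qed.

Lemma wp_ReadTab v x y Q t rs mem o :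
  tab (nth 0 rs y) = v -> v < 2 ^ w ->
  Q (set_nth 0 rs x v) mem o -> wp (ReadTab x y) Q t.+1 rs mem o.
Proof.
move=> ev vw Qs f ef; rewrite -!ef in ev.
exists (update f x v), (set_nth 0 rs x v), mem, o, 1.
split=> //; last exact: update_list.
by rewrite -{}ev in vw *; exact: (@exec_ReadTab w tab x y (State f mem o) vw).
Qed.

Lemma wp_WriteMem x y Q t rs mem o :
  Q rs (update mem (nth 0 rs x) (nth 0 rs y)) o ->
  wp (WriteMem x y) Q t.+1 rs mem o.
Proof.
move=> Qs f ef; rewrite -!ef in Qs.
exists f, rs, (update mem (f x) (f y)), o, 1.
by split=> //; exact: (@exec_WriteMem w tab x y (State f mem o)).
Qed.

Lemma wp_Output l Q t rs mem o :
  Q rs mem (rcons o l) -> wp (Output l) Q t.+1 rs mem o.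
Proof.
move=> Qs f ef; exists f, rs, mem, (rcons o l), 1.
by split=> //; exact: (@exec_Output w tab l (State f mem o)).
Qed.

Lemma wp_Seq t1 t2 c1 c2 Q rs mem o :
  wp c1 (wp c2 Q t2) t1 rs mem o -> wp (Seq c1 c2) Q (t1 + t2) rs mem o.
Proof.
move=> cP f /cP[f1 [rs1 [mem1 [o1 [s1 [ex1 st1 ef1 +]]]]]].
case/(_ _ ef1)=> [f2 [rs2 [mem2 [o2 [s2 [ex2 st2 ef2 Q2]]]]]].
exists f2, rs2, mem2, o2, (s1 + s2); split=> //; last exact: leq_add.
exact: exec_Seq ex1 ex2.
Qed.

Lemma wp_Seq1 c1 c2 Q t rs mem o :
  wp c1 (wp c2 Q t) 1 rs mem o -> wp (Seq c1 c2) Q t.+1 rs mem o.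
Proof. exact: wp_Seq. Qed.

Lemma wp_If b c1 c2 Q t rs mem o :
  (test_list b rs -> wp c1 Q t rs mem o) ->
  (~~ test_list b rs -> wp c2 Q t rs mem o) ->
  wp (If b c1 c2) Q t.+1 rs mem o.
Proof.
move=> c1P c2P f ef; case: (boolP (test_list b rs)) => test_b.
  have [f' [rs' [mem' [o' [s [? ? ? ?]]]]]] := c1P test_b f ef.
  exists f', rs', mem', o', s.+1; split=> //.
  by apply: exec_IfTrue; rewrite // (eval_test_list _ _ _ ef).
have [f' [rs' [mem' [o' [s [? ? ? ?]]]]]] := c2P test_b f ef.
exists f', rs', mem', o', s.+1; split=> //.
by apply: exec_IfFalse; rewrite // (eval_test_list _ _ _ ef).
Qed.

(* The first argument of the invariant [I] bounds the number of remaining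
   iterations. *)
Lemma wp_While (I : nat -> seq nat -> (nat -> nat) -> seq label -> Prop)
    k tb b c Q rs mem o :
  (forall k rs mem o, I k rs mem o -> test_list b rs ->
     0 < k /\ wp c (I k.-1) tb rs mem o) ->
  (forall k rs mem o, I k rs mem o -> ~~ test_list b rs -> Q rs mem o) ->
  I k rs mem o -> wp (While b c) Q (k * tb.+1 + 1) rs mem o.
Proof.
move=> step exit; elim: k rs mem o => [|k IH] rs mem o Ik f ef;
  case: (boolP (test_list b rs)) => test_b.
- by have [] := step _ _ _ _ Ik test_b.
- exists f, rs, mem, o, 1; split; rewrite ?addn1 //; last exact: exit Ik test_b.
  by apply: exec_WhileFalse; rewrite (eval_test_list _ _ _ ef).
- have [_ cP] := step _ _ _ _ Ik test_b.
  have [f1 [rs1 [mem1 [o1 [s1 [ex1 st1 ef1 I1]]]]]] := cP f ef.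
  have [f2 [rs2 [mem2 [o2 [s2 [ex2 st2 ef2 Q2]]]]]] := IH _ _ _ I1 _ ef1.
  exists f2, rs2, mem2, o2, (s1 + s2).+1; split=> //; last by rewrite /= in st2; lia.
  by apply: exec_WhileTrue ex1 ex2; rewrite (eval_test_list _ _ _ ef).
exists f, rs, mem, o, 1; split; rewrite ?addn1 //; last exact: exit Ik test_b.
by apply: exec_WhileFalse; rewrite (eval_test_list _ _ _ ef).
Qed.

End ProgramLogic.

Ltac step_op v :=
  apply: wp_Seq1; apply: (@wp_Op _ _ v); [rewrite /= | | cbn [nth set_nth ncons iter]].
Ltac step_mem v :=
  apply: wp_Seq1; apply: (@wp_ReadMem _ _ v); [rewrite /= | | cbn [nth set_nth ncons iter]].
Ltac step_tab v :=
  apply: wp_Seq1; apply: (@wp_ReadTab _ _ v); [rewrite /= | | cbn [nth set_nth ncons iter]].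
Ltac step_const :=
  apply: wp_Seq1; apply: wp_Const; [| cbn [nth set_nth ncons iter]].
Ltac step_move :=
  apply: wp_Seq1; apply: wp_Move; [rewrite /= | cbn [nth set_nth ncons iter]].
Ltac step_write := apply: wp_Seq1; apply: wp_WriteMem; cbn [nth set_nth ncons iter].

(** * The two programs *)

Fixpoint block (cs : seq cmd) : cmd :=
  match cs with
  | [::] => Skip
  | [:: c] => c
  | c :: cs' => Seq c (block cs')
  end.

(* Entry [psum D k m i] of the table is stored at address [addr D n m k i]. *)
Definition addr (D n m k i : nat) : nat := (m * D.+1 + k) * n + i.

(** Decodes the digits of an address formed by [addr]. *)
Definition tabval (D n a : nat) : nat :=
  psum D (a %/ n %% D.+1) (a %/ n %/ D.+1) (a %% n).

(* Registers: 0 = n, 1 = next address, 2 = size of the table, 3 = 1, 4 = D + 1,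
   6, 7, 8 = k, m, i for the current address, 11 = current address, 12 = 0,
   13 = D. Memory is zero initially, so zero entries are not written. *)
Definition precompute (D : nat) : cmd := block [::
  Const 13 D; Const 12 0; Const 4 D.+1; Const 3 1; Const 1 0;
  Op 2 Mul 0 0; Op 2 Mul 2 4;
  While (TestLt 1 2) (block [::
    Op 5 Div 1 0; Op 9 Mul 5 0; Op 8 Sub 1 9;
    Op 7 Div 5 4; Op 9 Mul 7 4; Op 6 Sub 5 9;
    Move 11 1; Op 1 Add 1 3;
    If (TestEq 8 12) (If (TestEq 7 12) (WriteMem 11 3) Skip)
    (If (TestEq 6 12) Skip
    (If (TestLt 7 8) Skip (block [::
      Op 8 Sub 8 3;
      Op 9 Mul 8 4; Op 9 Add 9 13; Op 9 Mul 9 0; Op 9 Add 9 8; ReadMem 9 9;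
      Op 7 Sub 7 3; Op 7 Sub 7 8; Op 6 Sub 6 3;
      Op 10 Mul 7 4; Op 10 Add 10 6; Op 10 Mul 10 0; Op 10 Add 10 7; ReadMem 10 10;
      Op 9 Mul 9 10;
      Op 10 Sub 11 3; ReadMem 10 10;
      Op 9 Add 10 9;
      WriteMem 11 9])))])].

(* A frame (k, m, r) on the stack stands for the r-th forest of [forests D k m],
   with r counted from 0.
   Registers: 0 = n, 1 = R, later k - 1, 2 = stack pointer, 3 = 1, 4 = D + 1,
   5 = D, 6, 7, 8 = k, m, r for the current frame, 9 = address of its row,
   10, 11 = bounds of the binary search, 14 = 2, 16 = lower bound plus 1,
   17 = 0, 18 = 3. *)
Definition bisect : cmd :=
  While (TestLt 16 11) (block [::
    Op 12 Add 10 11; Op 12 Div 12 14; Op 15 Add 9 12; ReadTab 13 15;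
    If (TestLt 8 13) (Move 11 12) (block [:: Move 10 12; Op 16 Add 10 3])]).

(** The remaining forest is pushed before the children of the first tree, so the children end up on
    top and are output first, as pre-order requires. *)
Definition expand_frame : cmd := block [::
  Op 9 Mul 7 4; Op 9 Add 9 6; Op 9 Mul 9 0;
  Const 10 0; Move 11 7; Const 16 1;
  bisect;
  Op 15 Add 9 10; ReadTab 13 15; Op 8 Sub 8 13;
  Op 7 Sub 7 11; Op 1 Sub 6 3;
  Op 15 Mul 7 4; Op 15 Add 15 1; Op 15 Mul 15 0; Op 15 Add 15 7; ReadTab 13 15;
  Op 12 Div 8 13; Op 15 Mul 12 13; Op 8 Sub 8 15;
  WriteMem 2 1; Op 2 Add 2 3; WriteMem 2 7; Op 2 Add 2 3; WriteMem 2 8; Op 2 Add 2 3;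
  WriteMem 2 5; Op 2 Add 2 3; WriteMem 2 10; Op 2 Add 2 3; WriteMem 2 12; Op 2 Add 2 3;
  If (TestEq 6 5)
    (If (TestEq 7 17) (Output lab_s) (Output lab_l))
    (If (TestEq 7 17) (Output lab_r) (Output lab_m))].

(** The root is output at once; the initial frame is the forest of its children, with the rank
    shifted to start from 0. *)
Definition unrank (D : nat) : cmd := block [::
  Const 18 3; Const 17 0; Const 14 2; Const 5 D; Const 4 D.+1; Const 3 1;
  Output lab_s;
  Op 15 Sub 0 3; Op 8 Sub 1 3;
  WriteMem 17 5; WriteMem 3 15; WriteMem 14 8; Move 2 18;
  While (TestLt 17 2) (block [::
    Op 2 Sub 2 18; ReadMem 6 2;
    Op 15 Add 2 3; ReadMem 7 15; Op 15 Add 15 3; ReadMem 8 15;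
    If (TestEq 7 17) Skip expand_frame])].

(** * Correctness of the precomputation *)

Lemma addr_lt D n m m' k i : m' < m -> k <= D -> i < n ->
  addr D n m' k i < m * D.+1 * n.
Proof.
move=> m'm kD iN; rewrite /addr.
have h1 : m' * D.+1 + k < m * D.+1.
  have := leq_mul m'm (leqnn D.+1); rewrite mulSn; lia.
have := leq_mul h1 (leqnn n); rewrite mulSn; lia.
Qed.

Lemma tabval_addr D n m k i : k <= D -> i < n ->
  tabval D n (addr D n m k i) = psum D k m i.
Proof.
move=> kD iN; have n0 : 0 < n by lia.
rewrite /tabval /addr divnMDl // divn_small // addn0 modnMDl modn_small //.
by rewrite divnMDl // divn_small // addn0 modnMDl modn_small.
Qed.

(** After 7 initial instructions there is one iteration per table entry: 40 bounds its body and 1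
    pays for the test. *)
Lemma precompute_spec D n w :
  0 < n -> n * n * D.+1 < 2 ^ w -> 2 ^ (2 * n) < 2 ^ w ->
  wp w no_table (precompute D)
    (fun _ mem _ => forall a,
       mem a = if a < n * n * D.+1 then tabval D n a else 0)
    (7 + (n * n * D.+1 * 41 + 1)) [:: n] (fun=> 0) [::].
Proof.
move=> n0 bigT bigC.
have nn : n <= n * n by rewrite leq_pmulr.
have nnD : n * n <= n * n * D.+1 by rewrite leq_pmulr.
have nDn : D.+1 <= n * n * D.+1 by rewrite leq_pmull // muln_gt0 n0.
rewrite /precompute; cbn [block addn].
do 5! [step_const; first lia].
step_op (n * n) => //; first lia.
step_op (n * n * D.+1) => //.
set T := n * n * D.+1 in bigT nnD nDn *.
(* [k] entries remain. Memory from [a] on is zero, so a zero entry is correct without a write. *)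
pose I k rs (mem : nat -> nat) (o : seq label) :=
  exists a x5 x6 x7 x8 x9 x10 x11,
  [/\ rs = [:: n; a; T; 1; D.+1; x5; x6; x7; x8; x9; x10; x11; 0; D], a + k = T
    & forall b, mem b = if b < a then tabval D n b else 0].
apply: (wp_While (I := I)); first last.
- by exists 0, 0, 0, 0, 0, 0, 0, 0; split.
- move=> k rs mem o [a [? [? [? [? [? [? [? [-> aT memE]]]]]]]]] /= aT' b.
  by rewrite memE; have -> : a = T by lia.
move=> {}k rs mem o [a [? [? [? [? [? [? [? [-> aT memE]]]]]]]]] /= aT'.
split; first lia.
have := divn_eq a n; have := ltn_pmod a n0.
set q := a %/ n; set i := a %% n => iN aE.
have := divn_eq q D.+1; have := ltn_pmod q (ltn0Sn D).
set m := q %/ D.+1; set k' := q %% D.+1 => kD qE.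
have qlt : q < n * D.+1 by rewrite ltn_divLR // mulnAC.
have mN : m < n by rewrite ltn_divLR.
have aA : a = addr D n m k' i by rewrite /addr -qE.
have qn : q * n <= a by lia.
have qa : q <= a by apply: leq_trans qn; rewrite leq_pmulr.
cbn [block].
step_op q => //; first lia.
step_op (q * n) => //; first lia.
step_op i; [lia | lia |].
step_op m => //; first lia.
step_op (m * D.+1) => //; first lia.
step_op k'; [lia | lia |].
step_move; first lia.
step_op a.+1; [lia | lia |].
have tabE : tabval D n a = psum D k' m i by rewrite aA tabval_addr.
have memS v : psum D k' m i = v ->
    forall b, update mem a v b = if b < a.+1 then tabval D n b else 0.
  move=> vE b; rewrite /update memE ltnS [b <= a]leq_eqVlt.
  by case: eqP => [->|] /=; rewrite ?tabE.
have mem0 : psum D k' m i = 0 ->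
    forall b, mem b = if b < a.+1 then tabval D n b else 0.
  move=> vE b; rewrite memE ltnS [b <= a]leq_eqVlt.
  by case: eqP => [->|] /=; rewrite ?ltnn ?tabE.
apply: wp_If => /= [/eqP i0|i0].
  apply: wp_If => /= [/eqP m0|m0].
    apply: wp_WriteMem => /=; exists a.+1; do 7!eexists; split; first reflexivity.
      by lia.
    by apply: memS; rewrite i0 m0.
  apply: wp_Skip; exists a.+1; do 7!eexists; split; first reflexivity.
    by lia.
  by apply: mem0; rewrite i0 /psum /= (negbTE m0).
apply: wp_If => /= [/eqP k0|k0].
  apply: wp_Skip; exists a.+1; do 7!eexists; split; first reflexivity.
    by lia.
  by apply: mem0; rewrite /psum (negbTE i0) k0.
apply: wp_If => /= [mi|im].
  apply: wp_Skip; exists a.+1; do 7!eexists; split; first reflexivity.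
    by lia.
  by apply: mem0; rewrite /psum (negbTE i0) mi orbT.
cbn [block].
(* Entries for smaller [m] have smaller addresses, so they are already filled. *)
have memA m' k'' i' : m' < m -> k'' <= D -> i' < n ->
    mem (addr D n m' k'' i') = psum D k'' m' i'.
  move=> *; rewrite memE ifT ?tabval_addr //.
  have := @addr_lt D n m m' k'' i'; rewrite [in a]aA /addr; lia.
have cntw k'' m' : m' < n -> cnt D k'' m' < 2 ^ w.
  by move=> /(@cnt_le D k'') /leq_ltn_trans; apply.
have addrw m' k'' i' : m' < m -> k'' <= D -> i' < n ->
  [/\ m' * D.+1 < 2 ^ w, m' * D.+1 + k'' < 2 ^ w,
      (m' * D.+1 + k'') * n < 2 ^ w & addr D n m' k'' i' < 2 ^ w].
  move=> m'm k''D i'n; have := addr_lt m'm k''D i'n; rewrite /addr.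
  have : m' * D.+1 + k'' <= (m' * D.+1 + k'') * n by rewrite leq_pmulr.
  have : m * D.+1 * n <= a by rewrite aA /addr mulnDl -addnA leq_addr.
  by move=> *; split; lia.
(* The factors of the new summand count forests with [i.-1] and [m - i] nodes, both fewer than
   [m]. *)
have i1m : i.-1 < m by lia.
have i1n : i.-1 < n by lia.
have m'm : m - i.-1.+1 < m by lia.
have m'n : m - i.-1.+1 < n by lia.
have k1D : k'.-1 <= D by lia.
have [c1 c2 c3 c4] := addrw _ _ _ i1m (leqnn D) i1n.
have [b1 b2 b3 b4] := addrw _ _ _ m'm k1D m'n.
have psE := @psumS D k' m i.-1.
step_op i.-1; [lia | lia |].
step_op (i.-1 * D.+1) => //.
step_op (i.-1 * D.+1 + D) => //.
step_op ((i.-1 * D.+1 + D) * n) => //.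
step_op (addr D n i.-1 D i.-1) => //.
step_mem (cnt D D i.-1); [by rewrite memA ?psum_all //; lia | by apply: cntw; lia |].
step_op m.-1; [lia | lia |].
step_op (m - i.-1.+1); [lia | lia |].
step_op (k'.-1); [lia | lia |].
set m' := m - i.-1.+1 in m'm m'n b1 b2 b3 b4 psE *.
step_op (m' * D.+1) => //.
step_op (m' * D.+1 + k'.-1) => //.
step_op ((m' * D.+1 + k'.-1) * n) => //.
step_op (addr D n m' k'.-1 m') => //.
step_mem (cnt D k'.-1 m'); [by rewrite memA ?psum_all //; lia | by apply: cntw; lia |].
(* The new entry is at most a count, so neither the product nor the sum overflows. *)
have psw := psum_le_cnt D k' m i.
have iS : i.-1.+1 = i by lia.
rewrite iS in psE; have {}psE := psE _ _; rewrite psE in psw; try lia.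
have cw := cntw k' m mN.
step_op (cnt D D i.-1 * cnt D k'.-1 m') => //; first lia.
step_op (addr D n m k' i.-1); [by rewrite aA /addr; lia | by rewrite /addr; lia |].
step_mem (psum D k' m i.-1); [| lia |].
  by rewrite memE ifT ?tabval_addr //; rewrite ?[in a]aA /addr; lia.
step_op (psum D k' m i.-1 + cnt D D i.-1 * cnt D k'.-1 m') => //; first lia.
apply: wp_WriteMem => /=; exists a.+1; do 7!eexists; split; first reflexivity.
  by lia.
by apply: memS; rewrite psE //; lia.
Qed.

(** * Correctness of unranking *)

Definition frame : Type := (nat * nat * nat)%type.

Definition frame_code (D : nat) (f : frame) : seq label :=
  let: (k, m, r) := f in forest_code D k (nth [::] (forests D k m) r).

Definition frame_ok (D n : nat) (f : frame) : bool :=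
  let: (k, m, r) := f in [&& k <= D, m < n & r < cnt D k m].

Definition stack_nodes (fs : seq frame) : nat := sumn [seq f.1.2 | f <- fs].

(* Frames are listed from the top of the stack; [p] is the first free address. *)
Fixpoint stack_at (mem : nat -> nat) (fs : seq frame) (p : nat) : Prop :=
  match fs with
  | [::] => p = 0
  | (k, m, r) :: fs' =>
      exists p', [/\ p = p'.+3, mem p' = k, mem p'.+1 = m, mem p'.+2 = r
                   & stack_at mem fs' p']
  end.

Lemma stack_at_size mem fs p : stack_at mem fs p -> p = 3 * size fs.
Proof.
elim: fs p => [|[[k m] r] fs IH] p //= [p' [-> _ _ _ /IH ->]]; lia.
Qed.

Lemma eq_stack_at mem mem' fs p :
  (forall a, a < p -> mem a = mem' a) -> stack_at mem fs p -> stack_at mem' fs p.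
Proof.
elim: fs p => [|[[k m] r] fs IH] p //= eqm [p' [pE m1 m2 m3 st]].
exists p'; split; rewrite -?eqm ?pE //; try lia.
by apply: IH st => a ap; apply: eqm; lia.
Qed.

Lemma stack_at_push mem fs p k m r : stack_at mem fs p ->
  stack_at (update (update (update mem p k) p.+1 m) p.+2 r) ((k, m, r) :: fs) p.+3.
Proof.
move=> st; exists p; rewrite /update !eqxx; split=> //; try by do ![case: eqP => //]; lia.
apply: eq_stack_at st => a ap; do ![case: eqP => //]; lia.
Qed.

Section Unrank.
Context (D n w : nat) (tab : nat -> nat).
Hypothesis n0 : 0 < n.
Hypothesis D0 : 0 < D.
Hypothesis bigT : n * n * D.+1 < 2 ^ w.
Hypothesis bigC : 2 ^ (2 * n) < 2 ^ w.
Hypothesis bigS : 3 * n + 3 < 2 ^ w.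
Hypothesis tabP : forall m k i, m < n -> k <= D -> i < n ->
  tab (addr D n m k i) = psum D k m i.

Lemma cnt_lt_word k m : m < n -> cnt D k m < 2 ^ w.
Proof. by move=> /(@cnt_le D k) /leq_ltn_trans; apply. Qed.

Lemma psum_lt_word k m i : m < n -> psum D k m i < 2 ^ w.
Proof. by move=> mn; apply: leq_ltn_trans (psum_le_cnt _ _ _ _) (cnt_lt_word _ _). Qed.

Lemma addr_lt_word m k i : m < n -> k <= D -> i < n ->
  [/\ m * D.+1 < 2 ^ w, m * D.+1 + k < 2 ^ w,
      (m * D.+1 + k) * n < 2 ^ w & addr D n m k i < 2 ^ w].
Proof.
move=> mn kD iN; have := addr_lt mn kD iN; rewrite mulnAC /addr.
have : m * D.+1 + k <= (m * D.+1 + k) * n by rewrite leq_pmulr.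
by move=> *; split; lia.
Qed.

Lemma D_lt_word : D.+1 < 2 ^ w.
Proof.
have : D.+1 <= n * n * D.+1 by rewrite leq_pmull // muln_gt0 n0.
lia.
Qed.

Definition regs x1 p k m r base lo hi x12 x13 x15 x16 : seq nat :=
  [:: n; x1; p; 1; D.+1; D; k; m; r; base; lo; hi; x12; x13; 2; x15; x16; 0; 3].

(** The search keeps [r] between the partial sums at [lo] and [hi]; each of the at most [c] rounds
    halves the bound on [hi - lo] with 7 units of time and a test. *)
Lemma bisect_spec x1 p k m r x12 x13 x15 c mem o :
  k <= D -> m < n -> 0 < m <= 2 ^ c -> r < cnt D k m ->
  wp w tab bisect
    (fun rs mem' o' => exists lo x12 x13 x15,
       [/\ rs = regs x1 p k m r ((m * D.+1 + k) * n) lo lo.+1 x12 x13 x15 lo.+1,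
           lo < m, psum D k m lo <= r < psum D k m lo.+1 & mem' = mem /\ o' = o])
    (c * 8 + 1)
    (regs x1 p k m r ((m * D.+1 + k) * n) 0 m x12 x13 x15 1) mem o.
Proof.
move=> kD mn /andP[m0 mc] rlt; rewrite /bisect.
pose I c rs (mem' : nat -> nat) (o' : seq label) := exists lo hi x12 x13 x15,
  [/\ rs = regs x1 p k m r ((m * D.+1 + k) * n) lo hi x12 x13 x15 lo.+1,
      lo < hi <= m, hi - lo <= 2 ^ c, psum D k m lo <= r < psum D k m hi
    & mem' = mem /\ o' = o].
apply: (wp_While (I := I)); first last.
(* Since [0 < m], the partial sum at 0 is 0; the one at [m] is the full count, above [r]. *)
- exists 0, m, x12, x13, x15; rewrite psum_all rlt andbT subn0 m0 leqnn.
  by split=> //; rewrite /psum /=; case: m m0 {mn mc rlt I}.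
- move=> {mc x12 x13 x15}c _ _ _ [lo [hi [x12 [x13 [x15 [-> lohi _ rb []-> ->]]]]]] /= hilo.
  have hiE : hi = lo.+1 by lia.
  by rewrite hiE in rb *; exists lo, x12, x13, x15; split=> //; lia.
move=> {mc x12 x13 x15}c _ _ _ [lo [hi [x12 [x13 [x15 [-> lohi hic rb []-> ->]]]]]] /= hilo.
case: c hic => [|c] hic; first by rewrite expn0 in hic; lia.
split=> //=; rewrite expnS in hic; cbn [block].
set mid := (lo + hi) %/ 2.
have midP : lo < mid < hi by lia.
have [b1 b2 b3 b4] := @addr_lt_word m k mid mn kD ltac:(lia).
step_op (lo + hi); [by [] | lia |].
step_op mid; [by [] | lia |].
step_op (addr D n m k mid) => //.
step_tab (psum D k m mid); [by rewrite tabP //; lia | exact: psum_lt_word |].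
apply: wp_If => /= rmid.
  apply: wp_Move => /=; first lia.
  exists lo, mid; do 3!eexists; split; first reflexivity; rewrite ?rmid ?andbT //; lia.
cbn [block]; step_move; first lia.
apply: (@wp_Op _ _ mid.+1) => /=; [lia | lia |].
by exists mid, hi; do 3!eexists; split; first reflexivity; rewrite //; lia.
Qed.

(** The loop invariant. Expanding a frame trades one node for one more frame, and popping an empty
    forest removes a frame: either way frames plus twice the nodes drops by one, which bounds the
    iterations, and frames plus nodes never grows, which bounds the stack. *)
Definition pending W z (rs : seq nat) (mem : nat -> nat) (o : seq label) : Prop :=
  exists fs p x1 x6 x7 x8 x9 x10 x11 x12 x13 x15 x16,
  [/\ rs = regs x1 p x6 x7 x8 x9 x10 x11 x12 x13 x15 x16, stack_at mem fs p,
      all (frame_ok D n) fs,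
      size fs + 2 * stack_nodes fs = z /\ size fs + stack_nodes fs <= n
    & o ++ flatten [seq frame_code D f | f <- fs] = W].

(** In the time bound, 6 instructions precede the binary search and 28 units follow it. *)
Lemma expand_frame_spec W x1 p k m r x9 x10 x11 x12 x13 x15 x16 fs c mem o :
  stack_at mem fs p -> all (frame_ok D n) ((k, m, r) :: fs) ->
  0 < m <= 2 ^ c -> (size fs).+1 + (m + stack_nodes fs) <= n ->
  o ++ flatten [seq frame_code D f | f <- (k, m, r) :: fs] = W ->
  wp w tab expand_frame
    (pending W (size fs + 2 * (m + stack_nodes fs))) (6 + (c * 8 + 1 + 28))
    (regs x1 p k m r x9 x10 x11 x12 x13 x15 x16) mem o.
Proof.
move=> st /= /andP[/and3P[kD mn rlt] ok_fs] mc room WE; rewrite /expand_frame /regs.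
have bD := D_lt_word; have pE := stack_at_size st.
have [a1 a2 a3 _] := @addr_lt_word m k m mn kD mn.
cbn [block addn].
step_op (m * D.+1) => //.
step_op (m * D.+1 + k) => //.
step_op ((m * D.+1 + k) * n) => //.
step_const; first lia.
step_move; first lia.
step_const; first lia.
apply: wp_Seq; apply: (wp_weaken (leqnn _)); last first.
  exact: (bisect_spec _ _ kD mn mc rlt).
move=> _ _ _ [lo [{}x12 [{}x13 [{}x15 [-> lom rb []-> ->]]]]]; rewrite /regs.
(* The search has found the number [lo] of nodes below the root of the first tree. *)
have [k0 qlt remlt nthE] := unrank_forest lom rb.
set r' := r - psum D k m lo in qlt remlt nthE.
set m' := m - lo.+1 in qlt remlt nthE.
set f := cnt D k.-1 m' in qlt remlt nthE.
have m'n : m' < n by lia.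
have k1D : k.-1 <= D by lia.
have lon : lo < n by lia.
have [_ _ _ a4] := @addr_lt_word m k lo mn kD lon.
have [b1 b2 b3 b4] := @addr_lt_word m' k.-1 m' m'n k1D m'n.
have rw := ltn_trans rlt (cnt_lt_word k mn).
have divE := divn_eq r' f.
have fw : f < 2 ^ w by exact: cnt_lt_word.
have qw := ltn_trans qlt (cnt_lt_word D lon).
step_op (addr D n m k lo) => //.
step_tab (psum D k m lo); [exact: tabP | exact: psum_lt_word |].
step_op r'; [by [] | lia |].
step_op m'; [by [] | lia |].
step_op k.-1; [lia | lia |].
step_op (m' * D.+1) => //.
step_op (m' * D.+1 + k.-1) => //.
step_op ((m' * D.+1 + k.-1) * n) => //.
step_op (addr D n m' k.-1 m') => //.
step_tab f; [by rewrite tabP // psum_all | by [] |].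
step_op (r' %/ f) => //.
step_op (r' %/ f * f); [by [] | lia |].
step_op (r' %% f); [lia | lia |].
step_write; step_op p.+1; [lia | lia |].
step_write; step_op p.+2; [lia | lia |].
step_write; step_op p.+3; [lia | lia |].
step_write; step_op p.+4; [lia | lia |].
step_write; step_op p.+3.+2; [lia | lia |].
step_write; step_op p.+3.+3; [lia | lia |].
have := stack_at_push D lo (r' %/ f) (stack_at_push k.-1 m' (r' %% f) st).
set mem' := update _ _ _ => st'.
set us := nth [::] (forests D D lo) _ in nthE.
set ts := nth [::] (forests D k.-1 m') _ in nthE.
(* The program tests for zero nodes where the code tests for an empty forest; these agree because
   every tree has a node. *)
have ts0 : nilp ts = (m' == 0).
  have := In_nth [::] remlt; rewrite -/ts => /In_forests[_ _ <-].
  by case: (ts) => // t ts' /=; case: (tsize t) (tsize_gt0 t).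
have done l : l = first_last_label (k == D) (m' == 0) -> forall x13 x15,
  pending W (size fs + 2 * (m + stack_nodes fs))
    (regs k.-1 p.+3.+3 k m' (r' %% f) ((m * D.+1 + k) * n) lo lo.+1 (r' %/ f)
       x13 x15 lo.+1) mem' (rcons o l).
  move=> -> {}x13 {}x15; exists [:: (D, lo, r' %/ f), (k.-1, m', r' %% f) & fs].
  do 12!eexists; split; first reflexivity; first exact: st'.
  - by rewrite /= leqnn lon qlt k1D m'n remlt.
  - by rewrite /stack_nodes /= -/(stack_nodes fs); lia.
  rewrite -WE cat_rcons /=; congr (_ ++ _).
  by rewrite nthE (forest_code_Node _ _ _ D0) ts0 /= -catA.
apply: wp_If => /= [kE|kE]; apply: wp_If => /= [mE|mE]; apply: wp_Output;
  by apply: done; rewrite ?kE ?mE ?(negbTE kE) ?(negbTE mE).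
Qed.

(** 13 instructions set up one frame with [n.-1] nodes, so the measure in [pending] starts at
    [2 * n - 1]. Each iteration spends 7 units on loading a frame and testing it for emptiness. *)
Lemma unrank_spec R c : 1 <= R <= cnt D D n.-1 -> n <= 2 ^ c ->
  wp w tab (unrank D)
    (fun _ _ o => o = codeword (Node (nth [::] (forests D D n.-1) R.-1)))
    (13 + ((2 * n - 1) * (7 + (6 + (c * 8 + 1 + 28))).+1 + 1)) [:: n; R] (fun=> 0) [::].
Proof.
move=> Rlt nc; have bD := D_lt_word.
have n1 : n.-1 < n by lia.
have cw := cnt_lt_word D n1.
rewrite /unrank; cbn [block addn].
do 6! [step_const; first lia].
apply: wp_Seq1; apply: wp_Output.
step_op n.-1; [lia | lia |].
step_op R.-1; [lia | lia |].
do 3!step_write; step_move; first lia.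
set W := codeword _; cbn [rcons].
apply: (wp_While (I := pending W)); first last.
- exists [:: (D, n.-1, R.-1)]; do 12!eexists; split; first reflexivity.
  + by exists 0; split.
  + by rewrite /= leqnn n1 /=; lia.
  + by rewrite /stack_nodes /=; lia.
  by rewrite /W /codeword (code_Node _ _ D0) /= cats0.
- move=> z rs mem o [fs [p [? [? [? [? [? [? [? [? [? [? [? [-> st _ _ WE]]]]]]]]]]]]]] /= p0.
  case: fs st WE => [|[[k m] r] fs] /=; first by rewrite cats0.
  by case=> p' [pE]; rewrite pE in p0.
move=> z rs mem o [fs [p [x1 [? [? [? [? [? [? [? [? [? [? [-> st ok [zE room] WE]]]]]]]]]]]]]] /= p0.
case: fs st ok zE room WE => [|[[k m] r] fs]; first by move=> /= pE; rewrite pE in p0.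
rewrite /stack_nodes /= -/(stack_nodes fs).
case=> p' [-> mk mm mr st] /andP[/and3P[kD mn rlt] ok_fs] zE room WE; split; first lia.
have pE := stack_at_size st; have rw := ltn_trans rlt (cnt_lt_word k mn).
rewrite /regs; cbn [block addn].
step_op p'; [lia | lia |].
step_mem k; [by [] | lia |].
step_op p'.+1; [lia | lia |].
step_mem m; [by [] | lia |].
step_op p'.+2; [lia | lia |].
step_mem r => //.
apply: wp_If => /= [/eqP m0|m0].
  apply: wp_Skip; exists fs; do 12!eexists; split; first reflexivity => //.
  - exact: st.
  - by [].
  - by split; lia.
  (* The default [[::]] of [nth] is itself the empty forest, so every [r] gives the same result. *)
  by rewrite -WE m0 forests0; case: (r) => [|[]].
have -> : z.-1 = size fs + 2 * (m + stack_nodes fs) by lia.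
apply: expand_frame_spec => //=; first by rewrite kD mn rlt.
by rewrite lt0n m0; lia.
Qed.

End Unrank.

(** * Word size and asymptotic bounds *)

Lemma word_size_bounds D n : 0 < n ->
  [/\ n * n * D.+1 < 2 ^ ((D + 5) * n), 2 ^ (2 * n) < 2 ^ ((D + 5) * n)
    & 3 * n + 3 < 2 ^ ((D + 5) * n)].
Proof.
move=> n0; split; last 2 first.
- by rewrite ltn_exp2l // ltn_pmul2r //; lia.
- have : 2 ^ n.+2 <= 2 ^ ((D + 5) * n) by rewrite leq_exp2l // mulnDl; lia.
  have : n < 2 ^ n by exact: ltn_expl.
  by rewrite !expnS; lia.
have hn : n < 2 ^ n by exact: ltn_expl.
have hD : D < 2 ^ D by exact: ltn_expl.
(* The exponent [2 * n + D] is below [(D + 5) * n] because [D <= D * n]. *)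
apply: leq_ltn_trans (_ : 2 ^ n * 2 ^ n * 2 ^ D < _).
  by apply: leq_mul => //; apply: leq_mul; exact: ltnW.
rewrite -!expnD ltn_exp2l // mulnDl.
have : D <= D * n by rewrite leq_pmulr.
lia.
Qed.

Theorem theorem6 (D : nat) (hD : 2 <= D) :
  exists (precompute unrank : cmd)
         (word_size table_size time_pre time_unrank : nat -> nat),
    [/\ bigO word_size (fun n => n),
        bigO table_size (fun n => n ^ 2),
        bigO time_pre (fun n => n ^ 2)
      & bigO time_unrank (fun n => n * trunc_log 2 n)] /\
    forall n : nat, 0 < n ->
      exists s : seq tree, A_sorted_list D n s /\
      exists (sp : state) (tp : nat),
        [/\ exec (word_size n) no_table precompute (init [:: n]) sp tp,
            tp <= time_pre n,
            (forall a, table_size n <= a -> memory sp a = 0)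
          & forall R : nat, 1 <= R <= size s ->
              exists (T : tree) (su : state) (tu : nat),
                [/\ onth s R.-1 = Some T,
                    exec (word_size n) (memory sp) unrank (init [:: n; R]) su tu,
                    tu <= time_unrank n
                  & out su = codeword T]].
Proof.
have D0 : 0 < D by lia.
exists (precompute D), (unrank D), (fun n => (D + 5) * n), (fun n => n * n * D.+1),
  (fun n => 7 + (n * n * D.+1 * 41 + 1)),
  (* [(trunc_log 2 n).+1] rounds of the search suffice, as [n] is at most that power of 2. *)
  (fun n => 13 + ((2 * n - 1) * (7 + (6 + ((trunc_log 2 n).+1 * 8 + 1 + 28))).+1 + 1)).
split; first split.
- by exists (D + 5), 0.
- by exists D.+1, 0 => n _; rewrite mulnC -mulnn.
- exists (41 * D.+1 + 8), 1 => n n1; rewrite -mulnn.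
  have : 0 < n * n by rewrite muln_gt0 n1.
  lia.
(* From [n = 2] on the logarithm is positive and absorbs the constant cost per node. *)
- exists 200, 2 => n n2.
  have L0 : 0 < trunc_log 2 n by rewrite trunc_log_gt0.
  move: (trunc_log 2 n) L0 => L L0; nia.
move=> n n0; have [bigT bigC bigS] := word_size_bounds D n0.
exists [seq Node ts | ts <- forests D D n.-1]; split.
  by case: n n0 {bigT bigC bigS} => // n _; apply: A_sorted_forests.
have [f [_ [mem [o [tp [exec_pre le_tp _ memE]]]]]] :=
  precompute_spec n0 bigT bigC (fun x => erefl (nth 0 [:: n] x)).
exists (State f mem o), tp; split=> //.
  by move=> a /= aT; rewrite memE ltnNge aT.
move=> R; rewrite size_map => Rlt.
have tabP m k i : m < n -> k <= D -> i < n -> mem (addr D n m k i) = psum D k m i.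
  move=> mn kD iN; rewrite memE ifT ?tabval_addr // mulnAC.
  exact: addr_lt.
have nc : n <= 2 ^ (trunc_log 2 n).+1 by apply/ltnW/trunc_log_ltn.
have [f' [_ [mem' [o' [tu [exec_un le_tu _ oE]]]]]] :=
  unrank_spec n0 D0 bigT bigC bigS tabP Rlt nc (fun x => erefl (nth 0 [:: n; R] x)).
exists (Node (nth [::] (forests D D n.-1) R.-1)), (State f' mem' o'), tu; split=> //.
rewrite onthE -map_comp (nth_map [::]) //.
by move: Rlt; rewrite /cnt; lia.
Qed.
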